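(* Let $C>0$ and let $(\gamma_j)\subset\Gamma_C$ be a sequence that converges uniformly on $I$ to $\gamma$. Then for all Lebesgue measurable sets $T\subset I$, $$\mathcal{H}^1(\gamma(T))\le\liminf_j\mathcal{H}^1(\gamma_j(T)).$$
   Context: $I=[0,1]$, $\mathcal{C}=[-1,1]^n$, $\Gamma_C$ is the set of Lipschitz paths $\gamma:I\to\mathcal{C}$ with Lipschitz constant at most $C$; $\mathcal{H}^1$ is the one-dimensional Hausdorff measure. *)

(* Defs.v *)
From mathcomp Require Import all_boot all_order all_algebra.
From mathcomp Require Import all_classical all_reals all_analysis.
Set Implicit Arguments.
Unset Strict Implicit.
Unset Printing Implicit Defensive.
Import Order.TTheory GRing.Theory Num.Theory.
Import numFieldNormedType.Exports.
Local Open Scope classical_set_scope.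
Local Open Scope ring_scope.

Section defs.
Context {R : realType}.

(* MathComp-Analysis equips 'rV_n with the sup norm; lengths and diameters are
   Euclidean, hence a separate norm. *)
Definition enorm {n : nat} (v : 'rV[R]_n) : R :=
  Num.sqrt (\sum_i v 0 i ^+ 2).

(* The point 0 is adjoined because ereal_sup set0 = -oo, while the diameter of
   the empty set is 0. *)
Definition ediam {n : nat} (A : set 'rV[R]_n) : \bar R :=
  ereal_sup (0%E |` [set (enorm (x - y))%:E | x in A & y in A]).

(* In dimension one the normalizing factor omega_1 / 2 of the Hausdorff measure
   is 1. *)
Definition hausdorff1_pre {n : nat} (delta : R) (A : set 'rV[R]_n) : \bar R :=
  ereal_inf [set (\sum_(0 <= k <oo) ediam (U k))%E
            | U in [set U : nat -> set 'rV[R]_n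
                   | A `<=` \bigcup_k U k /\
                     forall k, (ediam (U k) <= delta%:E)%E]].

Definition hausdorff1 {n : nat} (A : set 'rV[R]_n) : \bar R :=
  ereal_sup [set hausdorff1_pre delta A | delta in [set d : R | 0 < d]].

Definition unit_itv : set R := [set t : R | 0 <= t <= 1].

Definition cube {n : nat} : set 'rV[R]_n :=
  [set x | forall i, -1 <= x 0 i <= 1].

(* A path defined on [0, 1] is represented by any extension of it to R. *)
Definition lip_paths {n : nat} (C : R) : set (R -> 'rV[R]_n) :=
  [set g | (forall t, unit_itv t -> cube (g t)) /\
           (forall s t, unit_itv s -> unit_itv t ->
              enorm (g s - g t) <= C * `|s - t|)].

(* The canonical sigma-algebra on R is the Borel one; the Lebesgue sigma-algebra
   is the domain of completed_lebesgue_measure. *)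
Definition lebesgue_measurable (T : set R) : Prop :=
  (wlength idfun)^*%mu.-cara.-measurable T.

End defs.

(* Main.v *)
Require Import Defs.
From mathcomp Require Import all_boot all_order all_algebra.
From mathcomp Require Import all_classical all_reals all_analysis.
From mathcomp Require Import ring lra.
Import Order.TTheory GRing.Theory Num.Theory.
Import numFieldNormedType.Exports.
Local Open Scope classical_set_scope.
Local Open Scope ring_scope.


(** The inequality is a lower semicontinuity theorem of Golab type, for images
    of a measurable set [T] under uniformly converging, uniformly Lipschitz
    paths. The measure of an image counts overlapping pieces only once, so the
    danger is that the approximating paths overlap themselves more than the
    limit [g] does. A Vitali covering reduces the image of [g] to finitely many
    arcs with disjoint images, and these stay disjoint for the nearby paths.

    Upper bound ([hausdorff1_pre_le_arcs]). Let [U] be an open neighbourhood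
    of [T] with [U \ T] of small Lebesgue measure
    ([lebesgue_measurable_open_approx]). The arcs [g(J)], for short compact
    intervals [J] inside [U], form a fine cover of [g(T)]. Choosing intervals
    with pairwise disjoint images greedily, each of nearly maximal length,
    gives intervals J_0, J_1, ... that are themselves disjoint, so their lengths
    are summable. A point of [g(T)] outside the first [N] arcs lies in a ball of
    radius 3 C |J_i| around an endpoint of some later arc. Hence the
    [delta]-content of [g(T)] is at most the sum of the diameters of the first
    [N] arcs, up to an arbitrarily small error. Lengths in the parameter, rather
    than diameters of arcs, drive the selection, so arcs on which [g] is
    constant need no separate treatment.

    Lower bound ([arcs_le_hausdorff1]). Suppose that finitely many arcs of a
    [C]-Lipschitz path [h] are at distance greater than [d] from each other,
    and cover [h(T)] by sets of diameter at most [d]. Each set of the cover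
    meets at most one arc. By the intermediate value theorem the distance to
    one end of a chord of an arc takes all values between 0 and the length of
    the chord, and it is covered by the images of the sets of the cover
    together with that of [J \ T]. So the diameter of the arc is at most the
    sum of the diameters of the sets that meet it, plus C |J \ T|. Summing over
    the arcs, the total error is at most C |U \ T|.

    For large [j] the arcs of the [j]-th path over the intervals J_0, ...,
    J_(N-1) are still separated and have nearly the same diameters as those of
    [g]; comparing the two bounds gives the claim. *)

Local Notation leb := ((wlength idfun)^*%mu).

(** * The Euclidean norm *)

Section EuclideanNorm.
Context {R : realType} {n : nat}.
Implicit Types u v w : 'rV[R]_n.

Lemma enorm_ge0 u : 0 <= enorm u.
Proof. exact: sqrtr_ge0. Qed.

Lemma sqr_enorm u : enorm u ^+ 2 = \sum_i u 0 i ^+ 2.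
Proof. by rewrite sqr_sqrtr// sumr_ge0// => i _; exact: sqr_ge0. Qed.

Lemma enorm0 : enorm (0 : 'rV[R]_n) = 0.
Proof. by rewrite /enorm big1 ?sqrtr0// => i _; rewrite mxE expr0n. Qed.

Lemma normr_coord_le_enorm u i : `|u 0 i| <= enorm u.
Proof.
rewrite -(@ler_pXn2r _ 2)// ?nnegrE ?enorm_ge0//.
rewrite sqr_enorm real_normK ?num_real// (bigD1 i)//= lerDl sumr_ge0// => j _.
exact: sqr_ge0.
Qed.

Lemma enorm_eq0 u : enorm u = 0 -> u = 0.
Proof.
move=> u0; apply/rowP => i; rewrite mxE; apply/eqP.
by rewrite -normr_le0 -u0 normr_coord_le_enorm.
Qed.

Lemma enormN u : enorm (- u) = enorm u.
Proof.
by congr Num.sqrt; apply: eq_bigr => i _; rewrite mxE sqrrN.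
Qed.

Lemma enorm_distC u v : enorm (u - v) = enorm (v - u).
Proof. by rewrite -enormN opprB. Qed.

(** With [a] and [b] the norms of [u] and [v], expanding
    0 <= |b u - a v|^2 = 2 a b (a b - <u, v>) gives the bound as soon as [a b]
    is nonzero. *)
Lemma cauchy_schwarz_enorm u v : \sum_i u 0 i * v 0 i <= enorm u * enorm v.
Proof.
set a := enorm u; set b := enorm v.
have [a0|an0] := eqVneq a 0.
  by rewrite a0 mul0r (enorm_eq0 _ a0) big1// => i _; rewrite mxE mul0r.
have [b0|bn0] := eqVneq b 0.
  by rewrite b0 mulr0 (enorm_eq0 _ b0) big1// => i _; rewrite mxE mulr0.
have ab0 : 0 < a * b by rewrite mulr_gt0// lt_def ?an0 ?bn0 enorm_ge0.
have : 0 <= \sum_i (b * u 0 i - a * v 0 i) ^+ 2.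
  by apply: sumr_ge0 => i _; exact: sqr_ge0.
have -> : \sum_i (b * u 0 i - a * v 0 i) ^+ 2 =
    b ^+ 2 * \sum_i u 0 i ^+ 2 + a ^+ 2 * \sum_i v 0 i ^+ 2
    - 2 * (a * b) * \sum_i u 0 i * v 0 i.
  rewrite !mulr_sumr -sumrN -!big_split/=; apply: eq_bigr => i _; ring.
rewrite -!sqr_enorm -/a -/b => h.
rewrite -subr_ge0 -(pmulr_rge0 _ ab0); nra.
Qed.

Lemma enormD u v : enorm (u + v) <= enorm u + enorm v.
Proof.
rewrite -(@ler_pXn2r _ 2)// ?nnegrE ?addr_ge0 ?enorm_ge0//.
have -> : enorm (u + v) ^+ 2 =
    enorm u ^+ 2 + enorm v ^+ 2 + 2 * \sum_i u 0 i * v 0 i.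
  rewrite !sqr_enorm mulr_sumr -!big_split/=.
  by apply: eq_bigr => i _; rewrite mxE; ring.
have := cauchy_schwarz_enorm u v; nra.
Qed.

Lemma enorm_distD w u v : enorm (u - v) <= enorm (u - w) + enorm (w - v).
Proof.
apply: le_trans (enormD _ _); rewrite le_eqVlt; apply/orP; left; apply/eqP.
by congr enorm; rewrite addrA subrK.
Qed.

Lemma enorm_dist_dist u v : `|enorm u - enorm v| <= enorm (u - v).
Proof.
have := enormD (u - v) v; have := enormD (v - u) u; rewrite !subrK.
rewrite (enorm_distC v u) => h1 h2; rewrite ler_norml; apply/andP; split; lra.
Qed.

Lemma enorm_le_of_coord (d : R) u :
  0 <= d -> (forall i, `|u 0 i| <= d) -> enorm u <= n%:R * d.
Proof.
move=> d0 ud.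
rewrite -(@ler_pXn2r _ 2)// ?nnegrE ?mulr_ge0 ?enorm_ge0 ?ler0n//.
rewrite sqr_enorm (@le_trans _ _ (\sum_(i < n) d ^+ 2))//.
  apply: ler_sum => i _; rewrite -real_normK ?num_real//.
  by rewrite ler_pXn2r ?nnegrE.
rewrite sumr_const card_ord -[leLHS]mulr_natl exprMn ler_wpM2r ?sqr_ge0//.
by rewrite -natrX ler_nat; case: (n) => // k; rewrite leq_pmulr.
Qed.

End EuclideanNorm.

(** * Euclidean diameter *)

Section Diameter.
Context {R : realType} {n : nat}.
Implicit Types A V : set 'rV[R]_n.

Lemma ediam_le A (d : R) : 0 <= d ->
  (forall x y, A x -> A y -> enorm (x - y) <= d) -> (ediam A <= d%:E)%E.
Proof.
move=> d0 Ad; apply/ereal_supP => _ [->|[x Ax [y Ay <-]]].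
  by rewrite lee_fin.
by rewrite lee_fin; exact: Ad.
Qed.

Lemma ediam_ge0 A : (0 <= ediam A)%E.
Proof. by apply: ereal_sup_ubound; left. Qed.

Lemma enorm_le_ediam A x y : A x -> A y ->
  ((enorm (x - y))%:E <= ediam A)%E.
Proof. by move=> Ax Ay; apply: ereal_sup_ubound; right; exists x => //; exists y. Qed.

Lemma ediam_subset A (B : set 'rV[R]_n) : A `<=` B -> (ediam A <= ediam B)%E.
Proof.
move=> AB; apply/ereal_supP => _ [->|[x Ax [y Ay <-]]].
  exact: ediam_ge0.
by apply: enorm_le_ediam; exact: AB.
Qed.

Lemma ediam_image_le_near (f h : R -> 'rV[R]_n) (A : set R) (e : R) :
  0 <= e -> (forall t, enorm (f t - h t) <= e) ->
  (ediam (h @` A) <= ediam (f @` A) + (2 * e)%:E)%E.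
Proof.
move=> e0 fh; apply/ereal_supP => _ [->|[_ [s As <-] [_ [t At <-] <-]]].
  by rewrite adde_ge0 ?ediam_ge0// lee_fin mulr_ge0.
apply: (@le_trans _ _ ((enorm (f s - f t))%:E + (2 * e)%:E)%E); last first.
  by rewrite leeD2r//; apply: enorm_le_ediam; exists s + exists t.
rewrite -EFinD lee_fin.
have := enorm_distD (f s) (h s) (h t); have := enorm_distD (f t) (f s) (h t).
have := fh s; have := fh t; rewrite (enorm_distC (h s) (f s)); lra.
Qed.

(** A set of diameter at most [d] meets at most one of the sets [A i], since
    these lie at distance greater than [d] from each other: at most one term
    of the sum is nonzero. *)
Lemma sum_ediam_le_separated (N : nat) (A : nat -> set 'rV[R]_n)
    (V : set 'rV[R]_n) (d : R) :
  (forall i j, (i < j < N)%N -> forall x y, A i x -> A j y ->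
    d < enorm (x - y)) ->
  (ediam V <= d%:E)%E ->
  (\sum_(i < N) ediam (V `&` A i) <= ediam V)%E.
Proof.
move=> Asep Vd.
have ediam0 : ediam (set0 : set 'rV[R]_n) = 0%E.
  by apply/eqP; rewrite eq_le ediam_ge0 andbT; apply: ediam_le.
have [[i [x [Vx Aix]]]|none] := pselect (exists i : 'I_N, V `&` A i !=set0).
  rewrite (bigD1 i)//= big1 ?adde0; first by apply: ediam_subset => y [].
  move=> j ji; rewrite -[RHS]ediam0; congr ediam.
  apply/seteqP; split => // y [Vy Ajy].
  have := le_trans (enorm_le_ediam _ _ _ Vx Vy) Vd.
  rewrite lee_fin leNgt => /negP; apply.
  have [ij|ij|ij] := ltngtP i j.
  - by apply: (Asep i j) => //; rewrite ij ltn_ord.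
  - by rewrite enorm_distC; apply: (Asep j i) => //; rewrite ij ltn_ord.
  - by move/eqP: ji => ji; exfalso; apply: ji; apply/val_inj.
rewrite big1 ?ediam_ge0// => i _; rewrite -[RHS]ediam0; congr ediam.
apply/seteqP; split => // y Vy; apply: none; exists i; exists y.
exact: Vy.
Qed.

End Diameter.

(** * Lebesgue outer measure *)

Section LebesgueOuterMeasure.
Context {R : realType}.

Lemma leb_itv (i : interval R) :
  leb [set` i] = (if i.1 < i.2 then (i.2 : \bar R) - i.1 else 0)%E.
Proof. exact: lebesgue_measure_itv. Qed.

Lemma leb_ccitv (a b : R) : a <= b -> leb `[a, b] = (b - a)%:E.
Proof.
move=> ab; rewrite leb_itv/= lte_fin; case: ltP => //.
by move=> ba; rewrite (@le_anti _ _ a b) ?ab// subrr.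
Qed.

(** The closed interval from [inf A] to [sup A] contains [A]; an interval
    centred at a point of [A] would lose a factor 2. *)
Lemma leb_le_diam (A : set R) (d : R) : 0 <= d ->
  (forall x y, A x -> A y -> x - y <= d) -> (leb A <= d%:E)%E.
Proof.
move=> d0 Ad.
have [->|/set0P[x0 Ax0]] := eqVneq A set0; first by rewrite outer_measure0.
have lbA : has_lbound A.
  by exists (x0 - d) => y Ay; rewrite lerBlDr -lerBlDl; exact: Ad.
have ubA : has_ubound A.
  by exists (x0 + d) => y Ay; rewrite -lerBlDl; exact: Ad.
have supinf : sup A <= inf A + d.
  apply: ge_sup; first by exists x0.
  move=> x Ax; rewrite -lerBlDr; apply: lb_le_inf; first by exists x0.
  by move=> y Ay; rewrite lerBlDr -lerBlDl; exact: Ad.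
have infsup : inf A <= sup A.
  by rewrite (@le_trans _ _ x0)//; [exact: ge_inf|exact: ub_le_sup].
rewrite (@le_trans _ _ (leb `[inf A, sup A]))//.
  apply: le_outer_measure => x Ax /=.
  by rewrite in_itv/= ge_inf//= ub_le_sup.
by rewrite leb_ccitv// lee_fin lerBlDl.
Qed.

Lemma ccitv_caratheodory (a b : R) : leb.-caratheodory `[a, b].
Proof.
have : (R.-ocitv.-measurable).-sigma.-measurable `[a, b]%classic.
  exact: (@measurable_itv R `[a, b]).
exact: sub_caratheodory.
Qed.

(** The intervals are Caratheodory measurable, so they split the outer measure
    of every set additively. *)
Lemma leb_sum_disjoint (N : nat) (a b : nat -> R) (A : set R) :
  (forall i j, (i < j < N)%N -> `[a i, b i] `&` `[a j, b j] = set0) ->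
  (\sum_(i < N) leb (A `&` `[a i, b i]) <= leb A)%E.
Proof.
elim: N A => [|N ih] A ab; first by rewrite big_ord0 outer_measure_ge0.
rewrite big_ord_recr/= (ccitv_caratheodory (a N) (b N) A) addeC leeD2l//.
rewrite (le_trans _ (ih (A `&` ~` `[a N, b N]) _))//; last first.
  by move=> i j /andP[ij jN]; apply: ab; rewrite ij ltnS ltnW.
apply: lee_sum => i _; apply: le_outer_measure => x [Ax abx]; split=> //.
split=> // abNx; have : (`[a i, b i] `&` `[a N, b N]) x by [].
by rewrite ab ?ltn_ord ?ltnSn.
Qed.

(** The image of each interval in a cover of [S] has diameter at most [C] times
    the length of that interval. *)
Lemma leb_lipschitz_image (f : R -> R) (C : R) (S : set R) : 0 <= C ->
  (forall s t, `|f s - f t| <= C * `|s - t|) ->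
  (leb (f @` S) <= C%:E * leb S)%E.
Proof.
rewrite le_eqVlt => /predU1P[<- fC|C0 fC].
  rewrite mul0e; apply: leb_le_diam => // _ _ [s _ <-] [t _ <-].
  by rewrite (le_trans (ler_norm _))// -(mul0r `|s - t|).
rewrite -lee_pdivrMl//; apply: le_ereal_inf_tmp => _ [F [mF SF] <-].
rewrite lee_pdivrMl// -nneseriesZl//.
rewrite (@le_trans _ _ (leb (\bigcup_k (f @` F k))))//.
  apply: le_outer_measure => _ [s Ss <-].
  by have [k _ Fks] := SF s Ss; exists k => //; exists s.
apply: (le_trans (outer_measure_sigma_subadditive leb _)).
apply: lee_nneseries => [k _ _|k _]; first exact: outer_measure_ge0.
have /ocitvP[->|[[a b]/= ab ->]] := mF k.
  by rewrite image_set0 outer_measure0 wlength0 mule0.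
rewrite wlength_itv/= lte_fin ab -EFinB -EFinM; apply: leb_le_diam.
  by rewrite mulr_ge0 ?subr_ge0 ?ltW.
move=> _ _ [s + <-] [t + <-]; rewrite /= !in_itv/= => /andP[? ?] /andP[? ?].
rewrite (le_trans (ler_norm _))// (le_trans (fC _ _))// ler_wpM2l ?ltW//.
by rewrite ltr_norml; apply/andP; split; lra.
Qed.

(** The measurability of [T] is what turns outer regularity, a comparison of
    measures, into smallness of the excess [U `\` T]. *)
Lemma lebesgue_measurable_open_approx (T : set R) (e : R) : 0 < e ->
  lebesgue_measurable T -> (leb T < +oo)%E ->
  exists U, [/\ open U, T `<=` U, (leb U < +oo)%E & (leb (U `\` T) <= e%:E)%E].
Proof.
move=> e0 mT Too; have [U [oU TU Ue]] := outer_measure_open_le T e0.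
have {}Ue : (leb U <= leb T + e%:E)%E := Ue.
exists U; split => //.
  by rewrite (le_lt_trans Ue)// lte_add_pinfty ?ltry.
have cT : leb.-caratheodory T := mT.
move: Ue; rewrite (cT U) (setIidr TU) leeD2lE//.
by rewrite ge0_fin_numE ?outer_measure_ge0.
Qed.

End LebesgueOuterMeasure.

(** * Greedy selection of disjoint sets *)

Section GreedySelection.
Context {R : realType} {P X : Type}.
Variables (U : P -> set X) (w : P -> R) (G : set P) (p0 : P) (M : R).
Hypotheses (Gp0 : G p0) (Up0 : U p0 = set0) (wp0 : 0 <= w p0).
Hypothesis wM : forall p, G p -> w p <= M.

(** The weights are bounded, so some candidate has more than half of their
    supremum, unless all weights are nonpositive. The index [p0] of the empty
    set is then a valid choice, so the selection never stops and produces an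
    infinite sequence. *)
Lemma half_optimal_choice (S : set X) :
  exists p, [/\ G p, S `&` U p = set0 &
    forall q, G q -> S `&` U q = set0 -> w q <= 2 * w p].
Proof.
pose D := [set q | G q /\ S `&` U q = set0].
have Dp0 : D p0 by split => //; rewrite Up0 setI0.
have [[q Dq wq]|nopos] := pselect (exists2 q, D q & 0 < w q); last first.
  exists p0; split; [exact: Gp0 | exact: Dp0.2 | move=> q Gq SUq].
  rewrite (@le_trans _ _ 0)//; last by rewrite mulr_ge0.
  by rewrite leNgt; apply/negP => wq; apply: nopos; exists q.
have ubD : has_ubound (w @` D) by exists M => _ [r [Gr _] <-]; exact: wM.
have sup0 : 0 < sup (w @` D).
  by rewrite (lt_le_trans wq)//; apply: ub_le_sup => //; exists q.
have [_ [p [Gp SUp] <-] hp] :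
    exists2 x, (w @` D) x & sup (w @` D) / 2 < x.
  by apply: sup_gt; [exists (w q), q | lra].
exists p; split => // r Gr SUr.
have : w r <= sup (w @` D) by apply: ub_le_sup => //; exists r.
lra.
Qed.

(** The last property is the engine of Vitali coverings. If [U q] met no selected
    set, [q] would have been a candidate at every step, so all the selected
    weights would be at least half of its own. The first selected set that it
    meets was chosen when [q] was still a candidate, whence the factor 2. *)
Lemma greedy_disjoint_sequence : exists p : nat -> P,
  [/\ forall i, G (p i),
      forall i j, (i < j)%N -> U (p i) `&` U (p j) = set0 &
      forall q, G q -> (exists i, 2 * w (p i) < w q) ->
        exists2 k, U (p k) `&` U q !=set0 & w q <= 2 * w (p k)].
Proof.
have [f fP] := choice half_optimal_choice.
(* [S i] is the union of the sets selected before step [i]. *)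
pose S := fix S i := if i is i'.+1 then S i' `|` U (f (S i')) else set0.
have SU i j x : (i < j)%N -> U (f (S i)) x -> S j x.
  elim: j => // j ih; rewrite ltnS leq_eqVlt => /predU1P[->|ij] Ux.
    by right.
  by left; exact: ih.
have US j x : S j x -> exists2 i, (i < j)%N & U (f (S i)) x.
  elim: j => // j ih [/ih[i ij Ux]|Ux]; last by exists j.
  by exists i => //; exact: ltnW.
exists (fun i => f (S i)); split.
- by move=> i; case: (fP (S i)).
- move=> i j ij; apply/seteqP; split => // x [Ui Uj].
  case: (fP (S j)) => _ <- _; split; [exact: SU Ui | exact: Uj].
- move=> q Gq [i0 wi0]; apply: contrapT => hno.
  have Uq0 k : U (f (S k)) `&` U q = set0.
    elim/ltn_ind: k => k ih; apply: contrapT => /eqP/set0P kq.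
    apply: hno; exists k => //.
    case: (fP (S k)) => _ _; apply => //; apply/seteqP; split=> // x [Skx Uqx].
    have [i ik Uix] := US _ _ Skx.
    by rewrite -(ih i ik).
  have : w q <= 2 * w (f (S i0)).
    case: (fP (S i0)) => _ _; apply => //; apply/seteqP; split=> // x [Skx Uqx].
    have [i ik Uix] := US _ _ Skx.
    by rewrite -(Uq0 i).
  by rewrite leNgt wi0.
Qed.

End GreedySelection.

(** * Separation of disjoint arcs of a Lipschitz path *)

Lemma uniform_positive_bound {R : realType} (Q : nat -> R -> Prop) (N : nat) :
  (forall i x y, Q i x -> y <= x -> Q i y) ->
  (forall i, (i < N)%N -> exists2 x, 0 < x & Q i x) ->
  exists2 x, 0 < x & forall i, (i < N)%N -> Q i x.
Proof.
move=> Qle; elim: N => [|N ih] hQ; first by exists 1.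
have [|x x0 Qx] := ih; first by move=> i iN; apply: hQ; exact: ltnW.
have [y y0 Qy] := hQ N (ltnSn N).
exists (Num.min x y); first by rewrite lt_min x0.
move=> i; rewrite ltnS leq_eqVlt => /predU1P[->|iN].
  by apply: Qle Qy _; rewrite ge_min lexx orbT.
by apply: Qle (Qx i iN) _; rewrite ge_min lexx.
Qed.

Section LipschitzPaths.
Context {R : realType} {n : nat}.
Variables (g : R -> 'rV[R]_n) (C : R).
Hypothesis C0 : 0 < C.
Hypothesis gC : forall s t, enorm (g s - g t) <= C * `|s - t|.

Lemma lipschitz_continuous (f : R -> R) :
  (forall s t, `|f s - f t| <= C * `|s - t|) -> continuous f.
Proof.
move=> fC t; apply/cvgrPdist_le => /= e e0; near=> s.
rewrite (le_trans (fC _ _))// -ler_pdivlMl// mulrC.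
near: s; apply: cvgr_dist_le => //.
by rewrite divr_gt0.
Unshelve. all: by end_near. Qed.

(** The distance between points of the two arcs is a continuous positive function
    on a compact rectangle of parameters. *)
Lemma disjoint_arcs_apart (a b c d : R) :
  g @` `[a, b] `&` g @` `[c, d] = set0 ->
  exists2 e, 0 < e & forall s t, a <= s <= b -> c <= t <= d ->
    e <= enorm (g s - g t).
Proof.
move=> gg0.
have [ab|/set0P abcd] := eqVneq (`[a, b]%classic `*` `[c, d]%classic) set0.
  exists 1 => // s t sab tcd.
  have : (`[a, b]%classic `*` `[c, d]%classic) (s, t).
    by split; rewrite /= in_itv.
  by rewrite ab.
pose h (p : R * R) := enorm (g p.1 - g p.2).
have hc : continuous h.
  move=> p; apply/cvgrPdist_le => e e0.
  have e2 : 0 < e / 2 / C by rewrite !divr_gt0.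
  near=> q.
  have hpq : `|h p - h q| <= C * `|p.1 - q.1| + C * `|p.2 - q.2|.
    rewrite (le_trans (enorm_dist_dist _ _))//.
    rewrite (_ : _ - _ = (g p.1 - g q.1) + (g q.2 - g p.2)); last first.
      by apply/rowP => i; rewrite !mxE; ring.
    rewrite (le_trans (enormD _ _))// lerD//.
    by rewrite (le_trans (gC _ _))// distrC.
  have [h1 h2] : ball p (e / 2 / C) q by near: q; exact: (nbhsx_ballx (p : (R * R)%type) _ e2).
  rewrite (le_trans hpq)// [e]splitr lerD// -ler_pdivlMl// mulrC.
    exact: ltW.
  exact: ltW.
have [/= p] := compact_EVT_min abcd
  (compact_setX (@segment_compact _ a b) (@segment_compact _ c d))
  (continuous_subspaceT hc).
rewrite inE => -[pab pcd] hp.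
exists (h p).
  rewrite lt_def enorm_ge0 andbT; apply/eqP => hp0.
  have gp : g p.1 = g p.2 by apply/eqP; rewrite -subr_eq0; apply/eqP/enorm_eq0.
  have : (g @` `[a, b] `&` g @` `[c, d]) (g p.1).
    by split; [exists p.1 | exists p.2].
  by rewrite gg0.
by move=> s t sab tcd; apply: (hp (s, t)); rewrite inE; split; rewrite /= in_itv.
Unshelve. all: by end_near. Qed.

(** The separation survives small uniform perturbations of [g], whereas the
    mere disjointness of the arcs would not. *)
Lemma disjoint_arcs_uniformly_apart (N : nat) (a b : nat -> R) :
  (forall i j, (i < j)%N -> g @` `[a i, b i] `&` g @` `[a j, b j] = set0) ->
  exists2 d, 0 < d & forall i j, (i < j < N)%N -> forall u v,
    a i <= u <= b i -> a j <= v <= b j -> d <= enorm (g u - g v).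
Proof.
move=> disj.
have [||d d0 dP] := @uniform_positive_bound R (fun i d => forall j,
    (i < j < N)%N -> forall u v, a i <= u <= b i -> a j <= v <= b j ->
    d <= enorm (g u - g v)) N.
- by move=> i x y Qx yx j ij u v ui vj; exact: le_trans yx (Qx j ij u v ui vj).
- move=> i iN.
  have [||d d0 dP] := @uniform_positive_bound R (fun j d =>
      (i < j)%N -> forall u v, a i <= u <= b i -> a j <= v <= b j ->
      d <= enorm (g u - g v)) N.
  + by move=> j x y Qx yx ij u v ui vj; exact: le_trans yx (Qx ij u v ui vj).
  + move=> j jN; have [ij|ij] := ltnP i j; last by exists 1.
    have [d d0 dP] := disjoint_arcs_apart _ _ _ _ (disj i j ij).
    by exists d => // _; exact: dP.
  by exists d => // j /andP[ij jN]; exact: dP.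
by exists d => // i j /andP[ij jN]; apply: dP; rewrite ?ij// (ltn_trans ij).
Qed.

End LipschitzPaths.

(** * Vitali covering by arcs *)

Lemma nneseries_tail_le {R : realType} (f : nat -> \bar R) (h : R) :
  (forall i, (0 <= f i)%E) -> (\sum_(0 <= i <oo) f i < +oo)%E -> 0 < h ->
  exists N, (\sum_(N <= i <oo) f i <= h%:E)%E.
Proof.
move=> f0 foo h0.
have /fine_cvgP[tailfin /cvgrPdist_le/(_ _ h0) tailh] :
    (\sum_(N <= i <oo) f i @[N --> \oo] --> 0)%E.
  by apply: nneseries_tail_cvg => // i _; exact: f0.
near \oo => N; exists N.
have finN : (\sum_(N <= i <oo) f i)%E \is a fin_num by near: N.
rewrite -(fineK finN) lee_fin.
have : `|0 - fine (\sum_(N <= i <oo) f i)%E| <= h by near: N.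
by rewrite sub0r normrN; exact/le_trans/ler_norm.
Unshelve. all: by end_near. Qed.

Section VitaliCover.
Context {R : realType} {n : nat}.
Variables (g : R -> 'rV[R]_n) (C : R).
Hypothesis C0 : 0 < C.
Hypothesis gC : forall s t, enorm (g s - g t) <= C * `|s - t|.

(** The arcs are the first ones of a greedy selection, by length of the parameter
    interval; the rest of [g @` T] is covered by balls whose radii have a small
    sum. *)
Lemma hausdorff1_pre_le_arcs (U T : set R) (delta e : R) :
  open U -> T `<=` U -> (leb U < +oo)%E -> 0 < delta -> 0 < e ->
  exists N (a b : nat -> R),
  [/\ forall i, `[a i, b i] `<=` U,
      forall i j, (i < j)%N -> g @` `[a i, b i] `&` g @` `[a j, b j] = set0 &
      (hausdorff1_pre delta (g @` T) <=
        \sum_(i < N) ediam (g @` `[a i, b i]) + e%:E)%E].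
Proof.
move=> oU TU Uoo delta0 e0.
pose J (p : R * R) : set R := `[p.1, p.2]%classic.
pose len (p : R * R) := Num.max 0 (p.2 - p.1).
(* Intervals of length at most [r0] have arcs, and enlarged balls (of diameter
   6 C |J|), of diameter at most [delta]. *)
pose r0 := delta / (6 * C).
have r00 : 0 < r0 by rewrite divr_gt0// mulr_gt0.
pose G (p : R * R) := J p `<=` U /\ len p <= r0.
have len_ge0 p : 0 <= len p by rewrite /len le_max lexx.
have lenE0 p : (0 <= (len p)%:E)%E by rewrite lee_fin.
have lebJ p : leb (J p) = (len p)%:E.
  rewrite leb_itv/= lte_fin /len; case: ltP => [ab|ba].
    by rewrite max_r// subr_ge0 ltW.
  by rewrite max_l// subr_le0.
have Jlen p s t : J p s -> J p t -> `|s - t| <= len p.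
  rewrite /J /= !in_itv/= /len => /andP[? ?] /andP[? ?].
  rewrite (@le_trans _ _ (p.2 - p.1)) ?le_max ?lexx ?orbT//.
  by rewrite ler_norml; apply/andP; split; lra.
have J10 : J (1, 0) = set0 by rewrite /J/= set_itv_ge// -leNgt bnd_simp.
(* The pair (1, 0) stands for the empty interval. *)
have [p [Gp pdisj pmax]] : exists p : nat -> R * R,
  [/\ forall i, G (p i),
      forall i j, (i < j)%N -> g @` J (p i) `&` g @` J (p j) = set0 &
      forall q, G q -> (exists i, 2 * len (p i) < len q) ->
        exists2 k, g @` J (p k) `&` g @` J q !=set0 & len q <= 2 * len (p k)].
  apply: (@greedy_disjoint_sequence _ _ _ (fun p => g @` J p) len G (1, 0) r0).
  - by split; [rewrite J10|rewrite /len max_l ?ltW//=; lra].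
  - by rewrite J10 image_set0.
  - exact: len_ge0.
  - by move=> q [].
(* Intervals with disjoint images are disjoint. *)
have len_sum : (\sum_(0 <= i <oo) (len (p i))%:E <= leb U)%E.
  apply: lime_le; first by apply: is_cvg_nneseries => i _ _; exact: lenE0.
  apply: nearW => N; rewrite big_mkord.
  apply: le_trans (leb_sum_disjoint N (fun i => (p i).1) (fun i => (p i).2) U _).
    apply: lee_sum => i _; rewrite -lebJ le_outer_measure//.
    by move=> x Jx; split => //; apply: (Gp i).1.
  move=> i j /andP[ij _]; apply/seteqP; split => // x [Jix Jjx].
  have : (g @` J (p i) `&` g @` J (p j)) (g x) by split; exists x.
  by rewrite pdisj.
have tail_small (h : R) : 0 < h ->
    exists N, (\sum_(N <= i <oo) (len (p i))%:E <= h%:E)%E.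
  by move=> h0; apply: nneseries_tail_le => //; exact: le_lt_trans len_sum Uoo.
have [N tailN] : exists N, (\sum_(N <= i <oo) (len (p i))%:E <= (e / (6 * C))%:E)%E.
  by apply: tail_small; rewrite divr_gt0// mulr_gt0.
exists N, (fun i => (p i).1), (fun i => (p i).2); split.
- by move=> i; exact: (Gp i).1.
- exact: pdisj.
(* If an interval [q] around [t] satisfies |q| <= 2 |p k| and its arc meets
   that of [p k], then [g t] is at distance at most C |q| + C |p k|, hence
   3 C |p k|, from the starting point of the latter: this is the radius. *)
pose B i := [set y | enorm (y - g (p i).1) <= 3 * C * len (p i)].
pose V i := if (i < N)%N then g @` J (p i) else B i.
have diamB i : (ediam (B i) <= (6 * C * len (p i))%:E)%E.
  apply: ediam_le; first by rewrite mulr_ge0// mulr_ge0// ltW.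
  move=> x y; rewrite /B/= => Bx By.
  rewrite (le_trans (enorm_distD (g (p i).1) _ _))// enorm_distC.
  rewrite (enorm_distC _ y) in By *.
  rewrite enorm_distC; lra.
have V_covers : g @` T `<=` \bigcup_k V k.
  move=> _ [t Tt <-].
  have [[i iN Ji]|tNJ] := pselect (exists2 i, (i < N)%N & (g @` J (p i)) (g t)).
    by exists i => //; rewrite /V iN.
  have [h h0 hU] : exists2 h, 0 < h & forall s, `|s - t| <= h -> U s.
    have /nbhs_ballP[h /= h0 hU] := open_nbhs_nbhs (conj oU (TU _ Tt)).
    exists (h / 2); first by rewrite divr_gt0.
    move=> s st; apply: hU; rewrite /ball/= distrC; lra.
  have [h' h'0 h'J] : exists2 h, 0 < h & forall i, (i < N)%N ->
      forall s, `|s - t| <= h -> ~ (g @` J (p i)) (g s).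
    apply: (@uniform_positive_bound _ (fun i h =>
      forall s, `|s - t| <= h -> ~ (g @` J (p i)) (g s))).
      by move=> i x y Qx yx s st; apply: Qx; exact: le_trans st yx.
    move=> i iN.
    have [|d d0 dJ] := disjoint_arcs_apart g C C0 gC t t (p i).1 (p i).2.
      apply/seteqP; split => // _ [[s + <-] Js]; rewrite /= in_itv/=.
      move=> /le_anti ts; apply: tNJ; exists i => //.
      by rewrite ts.
    exists (d / (2 * C)); first by rewrite divr_gt0// mulr_gt0.
    move=> s st [u Ju gus].
    have := dJ t u; rewrite lexx gus => /(_ isT).
    move: (Ju); rewrite /J/= in_itv/= => -> /(_ isT).
    have := gC t s; rewrite (distrC t) => hts /le_trans/(_ hts).
    apply/negP; rewrite -ltNge (@le_lt_trans _ _ (d / 2))//; last lra.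
    rewrite (_ : d / 2 = C * (d / (2 * C))) ?ler_pM2l//.
    by field; rewrite gt_eqF.
  pose m := Num.min (Num.min h h') (r0 / 2).
  have m0 : 0 < m by rewrite !lt_min h0 h'0 divr_gt0.
  have mh : m <= h by rewrite /m !ge_min lexx.
  have mh' : m <= h' by rewrite /m !ge_min lexx orbT.
  have mr0 : m <= r0 / 2 by rewrite /m ge_min lexx orbT.
  pose q := (t - m, t + m).
  have lenq : len q = 2 * m.
    rewrite /len/= max_r; last by lra.
    by lra.
  have Jqm s : J q s -> `|s - t| <= m.
    rewrite /J/= in_itv/= => /andP[? ?].
    by rewrite ler_norml; apply/andP; split; lra.
  have Gq : G q.
    split; last by rewrite lenq; lra.
    by move=> s /Jqm sm; apply: hU; exact: le_trans mh.
  have Jqt : J q t by rewrite /J/= in_itv/=; apply/andP; split; lra.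
  have [k [_ [[v Jv <-] [u Ju guv]]] qk] :
      exists2 k, g @` J (p k) `&` g @` J q !=set0 & len q <= 2 * len (p k).
    apply: pmax => //.
    have [k hk] := tail_small (m / 2) (divr_gt0 m0 (ltr0Sn _ _)).
    exists k; rewrite lenq.
    suff : len (p k) <= m / 2 by lra.
    rewrite -lee_fin (le_trans _ hk)//.
    rewrite (nneseries_split _ 1)//.
    rewrite addn1 big_nat1 leeDl// nneseries_ge0// => *; exact: lenE0.
  exists k => //; rewrite /V ifF; last first.
    apply/negP => kN; apply: (h'J k kN u).
      by rewrite (le_trans (Jqm u Ju)).
    by exists v.
  have len_gt0 : 0 < len (p k) by lra.
  have Jp1 : J (p k) (p k).1.
    rewrite /J/= in_itv/= lexx/=.
    by move: Jv; rewrite /J/= in_itv/= => /andP[]; exact: le_trans.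
  rewrite /B/= (le_trans (enorm_distD (g u) _ _))//.
  have h1 := gC t u; have h2 := gC v (p k).1.
  have h3 := Jlen _ _ _ Jqt Ju; have h4 := Jlen _ _ _ Jv Jp1.
  rewrite [in enorm (g u - _)]guv.
  have h5 : C * `|t - u| <= C * (2 * len (p k)).
    by rewrite ler_pM2l// (le_trans h3).
  have h6 : C * `|v - (p k).1| <= C * len (p k) by rewrite ler_pM2l.
  lra.
have V_diam k : (ediam (V k) <= delta%:E)%E.
  rewrite /V; case: ifPn => _.
    apply: ediam_le; first exact: ltW.
    move=> _ _ [s Js <-] [t Jt <-].
    rewrite (le_trans (gC _ _))//.
    rewrite (@le_trans _ _ (C * r0))//.
      by rewrite ler_pM2l// (le_trans (Jlen _ _ _ Js Jt))//; exact: (Gp k).2.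
    rewrite /r0 (_ : C * _ = delta / 6); first lra.
    by field; rewrite gt_eqF.
  rewrite (le_trans (diamB k))// lee_fin.
  rewrite -ler_pdivlMl ?mulr_gt0// mulrC; exact: (Gp k).2.
apply: ereal_inf_le; exists (\sum_(0 <= k <oo) ediam (V k))%E.
  by exists V.
rewrite (nneseries_split _ N)//; last by move=> *; exact: ediam_ge0.
rewrite add0n; apply: leeD.
  rewrite big_mkord; apply: lee_sum => i _.
  by rewrite /V ltn_ord.
rewrite (@le_trans _ _ (\sum_(N <= k <oo) (6 * C)%:E * (len (p k))%:E)%E)//.
  rewrite [leLHS]eseries_cond [leRHS]eseries_cond.
  apply: lee_nneseries => [k _ _|k]; first exact: ediam_ge0.
  rewrite /= => Nk; rewrite /V ltnNge Nk /= -EFinM; exact: diamB.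
rewrite nneseriesZl//.
rewrite (@le_trans _ _ ((6 * C)%:E * (e / (6 * C))%:E)%E)//.
  by rewrite lee_pmul2l// lte_fin mulr_gt0.
rewrite -EFinM lee_fin le_eqVlt; apply/orP; left; apply/eqP.
by field; rewrite gt_eqF.
Qed.

End VitaliCover.

(** * Lower bound for the Hausdorff measure of an image *)

Section LowerBound.
Context {R : realType} {n : nat}.
Variables (g : R -> 'rV[R]_n) (C : R).
Hypothesis C0 : 0 < C.
Hypothesis gC : forall s t, enorm (g s - g t) <= C * `|s - t|.

(** The distance to [z] is nonexpansive. *)
Lemma leb_dist_image_le_ediam (A : set 'rV[R]_n) (z : 'rV[R]_n) :
  (leb [set enorm (y - z) | y in A] <= ediam A)%E.
Proof.
have := ediam_ge0 A; case dA : (ediam A) => [d| |]// d0; last by rewrite leey.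
apply: leb_le_diam; first by rewrite -lee_fin.
move=> _ _ [x Ax <-] [y Ay <-]; rewrite -lee_fin -dA.
apply: le_trans (enorm_le_ediam _ _ _ Ax Ay); rewrite lee_fin.
rewrite (le_trans (ler_norm _))// (le_trans (enorm_dist_dist _ _))//.
by rewrite le_eqVlt; apply/orP; left; apply/eqP; congr enorm;
  apply/rowP => i; rewrite !mxE; ring.
Qed.

(** The distance from [g s] maps the arc onto a set that contains the interval
    from 0 to the length of the chord. Points of the arc with parameter in [T]
    are covered by the [V k]; the other parameters contribute at most [C] times
    their measure. *)
Lemma chord_le_cover (T : set R) (V : nat -> set 'rV[R]_n) (s t : R) :
  s <= t -> g @` T `<=` \bigcup_k V k ->
  ((enorm (g t - g s))%:E <=
    \sum_(0 <= k <oo) ediam (V k `&` g @` `[s, t]) +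
    C%:E * leb (`[s, t] `\` T))%E.
Proof.
move=> st TV.
pose f u := enorm (g u - g s).
have fC u v : `|f u - f v| <= C * `|u - v|.
  rewrite (le_trans (enorm_dist_dist _ _))// (le_trans _ (gC u v))//.
  by rewrite le_eqVlt; apply/orP; left; apply/eqP; congr enorm;
    apply/rowP => i; rewrite !mxE; ring.
pose D k := [set enorm (y - g s) | y in V k `&` g @` `[s, t]].
have f0 : f s = 0 by rewrite /f subrr enorm0.
have covered : `[0, f t] `<=` (\bigcup_k D k) `|` f @` (`[s, t] `\` T).
  move=> y; rewrite /= in_itv/= => y0t.
  have [|u ust fuy] := @IVT R f s t y st (continuous_subspaceT
      (lipschitz_continuous C C0 _ fC)).
    by rewrite f0 min_l ?max_r ?enorm_ge0.
  have [Tu|nTu] := pselect (T u); last by right; exists u.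
  left; have [k _ Vk] := TV (g u) (imageP g Tu).
  by exists k => //; exists (g u) => //; split => //; exists u.
rewrite -/(f t) -[X in X%:E](subr0 (f t)) -leb_ccitv ?enorm_ge0//.
rewrite (le_trans (le_outer_measure leb _ _ covered))//.
rewrite (le_trans (outer_measureU2 leb _ _))// leeD//.
  rewrite (le_trans (outer_measure_sigma_subadditive leb _))//.
  apply: lee_nneseries => [k _ _|k _]; first exact: outer_measure_ge0.
  exact: leb_dist_image_le_ediam.
by apply: leb_lipschitz_image => //; exact: ltW.
Qed.

(** Every chord of the arc is estimated by the cover of the subarc that it
    subtends. *)
Lemma ediam_arc_le_cover (T : set R) (V : nat -> set 'rV[R]_n) (s t : R) :
  g @` T `<=` \bigcup_k V k ->
  (ediam (g @` `[s, t]) <=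
    \sum_(0 <= k <oo) ediam (V k `&` g @` `[s, t]) +
    C%:E * leb (`[s, t] `\` T))%E.
Proof.
move=> TV; apply/ereal_supP => _ [->|[_ [u ust <-] [_ [v vst <-] <-]]].
  apply: adde_ge0; first by apply: nneseries_ge0 => *; exact: ediam_ge0.
  by rewrite mule_ge0 ?outer_measure_ge0// lee_fin ltW.
wlog vu : u v ust vst / v <= u.
  move=> chord; have [|/ltW uv] := leP v u; first exact: chord.
  by rewrite enorm_distC; exact: chord.
apply: le_trans (chord_le_cover _ _ _ _ vu TV) _.
have sub : `[v, u] `<=` `[s, t].
  move: ust vst; rewrite /= !in_itv/= => /andP[su ut] /andP[sv vt] x /=.
  by rewrite !in_itv/= => /andP[vx xu]; rewrite (le_trans sv)//= (le_trans xu).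
apply: leeD.
  apply: lee_nneseries => [k _ _|k _]; first exact: ediam_ge0.
  by apply: ediam_subset; apply: setIS; exact: image_subset.
rewrite lee_pmul2l// ?lte_fin//; apply: le_outer_measure.
exact: setSD.
Qed.

(** Covers of [g @` T] by sets of diameter at most [d] suffice, as the Hausdorff
    measure dominates the [d]-content. Each set of such a cover is charged to at
    most one arc. *)
Lemma arcs_le_hausdorff1 (T U : set R) (N : nat) (s t : nat -> R)
    (d e : R) :
  0 < d ->
  (forall i, (i < N)%N -> `[s i, t i] `<=` U) ->
  (forall i j, (i < j < N)%N -> forall u v,
    s i <= u <= t i -> s j <= v <= t j -> d < enorm (g u - g v)) ->
  (leb (U `\` T) <= e%:E)%E ->
  (\sum_(i < N) ediam (g @` `[s i, t i]) <=
    hausdorff1 (g @` T) + (C * e)%:E)%E.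
Proof.
move=> d0 stU sep UTe.
rewrite -leeBlDr//; apply: (@le_trans _ _ (hausdorff1_pre d (g @` T))); last first.
  by apply: ereal_sup_ubound; exists d.
apply: le_ereal_inf_tmp => _ [V [TV Vd] <-]; rewrite leeBlDr//.
have sum_rest :
    (\sum_(i < N) leb (`[s i, t i] `\` T) <= e%:E)%E.
  rewrite (le_trans _ UTe)//.
  apply: le_trans (leb_sum_disjoint N s t (U `\` T) _).
    apply: lee_sum => i _; apply: le_outer_measure => x [six nTx].
    by split => //; split => //; apply: (stU i).
  move=> i j ijN; apply/seteqP; split => // x; rewrite /= !in_itv/= => -[xi xj].
  by have := sep _ _ ijN x x xi xj; rewrite subrr enorm0 ltNge ltW.
apply: (@le_trans _ _ (\sum_(i < N) (\sum_(0 <= k <oo)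
   ediam (V k `&` g @` `[s i, t i]) + C%:E * leb (`[s i, t i] `\` T)))%E).
  by apply: lee_sum => i _; exact: ediam_arc_le_cover.
rewrite big_split/= leeD//.
  rewrite -nneseries_sum; last by move=> *; exact: ediam_ge0.
  apply: lee_nneseries => [k _ _|k _].
    by apply: sume_ge0 => *; exact: ediam_ge0.
  apply: (sum_ediam_le_separated N (fun i => g @` `[s i, t i]) _ d) => //.
  move=> i j ijN _ _ [u + <-] [v + <-]; rewrite /= !in_itv/= => ? ?.
  exact: (sep i j).
rewrite -ge0_sume_distrr; last by move=> *; exact: outer_measure_ge0.
by rewrite EFinM lee_pmul2l// lte_fin.
Qed.

End LowerBound.

(** * Semicontinuity *)

Lemma le_limn_einf {R : realType} (u : nat -> \bar R) (x : \bar R) (N : nat) :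
  (forall j, (N <= j)%N -> (x <= u j)%E) -> (x <= limn_einf u)%E.
Proof.
move=> xu; rewrite limn_einf_lim (cvg_lim _ (@cvg_einfs_sup _ u))//.
apply: le_trans (ereal_sup_ubound (_ : range (einfs u) (einfs u N))).
  by apply: le_ereal_inf_tmp => _ [j /= Nj <-]; exact: xu.
by exists N.
Qed.

Section Semicontinuity.
Context {R : realType} {n : nat}.
Variables (C : R) (g_ : nat -> R -> 'rV[R]_n) (g : R -> 'rV[R]_n).
Hypothesis C0 : 0 < C.
Hypothesis g_C : forall j s t, enorm (g_ j s - g_ j t) <= C * `|s - t|.
Hypothesis gC : forall s t, enorm (g s - g t) <= C * `|s - t|.
Hypothesis g_cvg : forall e, 0 < e ->
  exists j0, forall j, (j0 <= j)%N -> forall t, enorm (g_ j t - g t) <= e.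

(** Three errors are to be absorbed by [e], in units of [h]: the uncovered rest
    of [g @` T] costs [h], the change of the diameters of the [N] arcs costs
    [h], and the excess [U `\` T] costs [C * h]. This fixes [h]. *)
Lemma hausdorff1_lower_semicontinuous (T : set R) :
  lebesgue_measurable T -> (leb T < +oo)%E ->
  (hausdorff1 (g @` T) <= limn_einf (fun j => hausdorff1 (g_ j @` T)))%E.
Proof.
move=> mT Too; apply: ge_ereal_sup => _ [delta /= delta0 <-].
apply/lee_addgt0Pr => e e0; rewrite -leeBlDr//.
pose h := e / (C + 2).
have C20 : 0 < C + 2 by rewrite addr_gt0.
have h0 : 0 < h by rewrite divr_gt0.
have [U [oU TU Uoo UTh]] := lebesgue_measurable_open_approx T h h0 mT Too.
have [N [a [b [abU disj Hle]]]] :=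
  hausdorff1_pre_le_arcs g C C0 gC U T delta h oU TU Uoo delta0 h0.
have [d d0 dP] := disjoint_arcs_uniformly_apart g C C0 gC N a b disj.
(* Perturbing [g] by [h'] changes each diameter by at most [2 * h'], and keeps
   the arcs at distance at least [d / 2]. *)
pose h' := Num.min (h / (2 * N.+1%:R)) (d / 4).
have h'0 : 0 < h' by rewrite lt_min !divr_gt0// mulr_gt0.
have h'h : 2 * h' *+ N <= h.
  have : h' <= h / (2 * N.+1%:R) by rewrite ge_min lexx.
  rewrite ler_pdivlMr ?mulr_gt0// -mulr_natr -natr1 => h'h.
  nra.
have h'd : h' <= d / 4 by rewrite ge_min lexx orbT.
have [j0 j0P] := g_cvg h' h'0.
apply: (@le_limn_einf _ _ _ j0) => j /j0P gj.
rewrite leeBlDr//.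
have sep i k : (i < k < N)%N -> forall u v,
    a i <= u <= b i -> a k <= v <= b k -> d / 4 < enorm (g_ j u - g_ j v).
  move=> ik u v ui vk; have := dP i k ik u v ui vk.
  have := enorm_distD (g_ j u) (g u) (g v).
  have := enorm_distD (g_ j v) (g_ j u) (g v).
  have := gj u; have := gj v; rewrite (enorm_distC (g u) (g_ j u)); lra.
have d40 : 0 < d / 4 by rewrite divr_gt0.
have lower := arcs_le_hausdorff1 (g_ j) C C0 (g_C j) T U N a b (d / 4) h
  d40 (fun i _ => abU i) sep UTh.
rewrite (le_trans Hle)//.
rewrite (@le_trans _ _ (\sum_(i < N) (ediam (g_ j @` `[a i, b i]) + (2 * h')%:E)
    + h%:E)%E)//.
  rewrite leeD2r//; apply: lee_sum => i _; apply: ediam_image_le_near => //.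
  exact: ltW.
rewrite big_split/= sumEFin sumr_const card_ord.
rewrite (@le_trans _ _ (hausdorff1 (g_ j @` T) + (C * h)%:E + h%:E + h%:E)%E)//.
  by rewrite leeD2r// leeD// lee_fin.
rewrite -!addeA -!EFinD leeD2l// lee_fin le_eqVlt; apply/orP; left; apply/eqP.
by rewrite /h; field; rewrite gt_eqF.
Qed.

End Semicontinuity.

Section Clamp.
Context {R : realType}.
Implicit Types s t : R.

(** Composition with the nearest-point projection onto the unit interval extends
    the paths to globally Lipschitz maps with the same images of [T]. *)
Definition clamp01 t : R := Num.max 0 (Num.min 1 t).

Lemma clamp01_unit t : unit_itv (clamp01 t).
Proof. by rewrite /unit_itv/= le_max lexx/= ge_max ler01 ge_min lexx. Qed.

Lemma clamp01_id t : unit_itv t -> clamp01 t = t.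
Proof. by move=> /andP[t0 t1]; rewrite /clamp01 min_r// max_r. Qed.

Lemma clamp01_nonexpansive s t : `|clamp01 s - clamp01 t| <= `|s - t|.
Proof.
have clampP x : [\/ x <= 0 /\ clamp01 x = 0, 0 <= x <= 1 /\ clamp01 x = x |
                   1 <= x /\ clamp01 x = 1].
  have [x0|/ltW x0] := leP x 0.
    by apply: Or31; rewrite /clamp01 min_r ?max_l// (le_trans x0).
  have [x1|/ltW x1] := leP x 1.
    by apply: Or32; rewrite clamp01_id /unit_itv/= ?x0.
  by apply: Or33; rewrite /clamp01 min_l ?max_r.
have le_clamp x y : x <= y -> 0 <= clamp01 y - clamp01 x <= y - x.
  by case: (clampP x) => -[? ->]; case: (clampP y) => -[? ->]; lra.
have [/le_clamp|/ltW/le_clamp] := leP s t.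
  by rewrite distrC (distrC s) => /andP[? ?]; rewrite !ger0_norm//; lra.
by move=> /andP[? ?]; rewrite !ger0_norm//; lra.
Qed.

End Clamp.

Theorem proposition2p1p5 (R : realType) (n : nat) (C : R) (hC : 0 < C)
    (gamma_ : nat -> R -> 'rV[R]_n) (gamma : R -> 'rV[R]_n)
    (hgamma_ : forall j : nat, lip_paths C (gamma_ j))
    (hcvg : {uniform unit_itv, gamma_ @ \oo --> gamma})
    (T : set R) (hTI : T `<=` unit_itv) (hT : lebesgue_measurable T) :
  (hausdorff1 (gamma @` T)
     <= limn_einf (fun j : nat => hausdorff1 (gamma_ j @` T)))%E.
Proof.
have near_gamma e : 0 < e -> exists j0, forall j, (j0 <= j)%N ->
    forall t, unit_itv t -> enorm (gamma_ j t - gamma t) <= e.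
  move=> e0.
  have n0 : (0 : R) < n.+1%:R by [].
  have en0 : 0 < e / n.+1%:R by rewrite divr_gt0.
  have [|j0 _ hj] := hcvg [set h : R -> 'rV[R]_n |
      forall t, unit_itv t -> ball (gamma t) (e / n.+1%:R) (h t)].
    apply/uniform_nbhs; exists [set xy | ball xy.1 (e / n.+1%:R) xy.2].
    by split => //; exact: (entourage_ball _ (PosNum en0)).
  exists j0 => j j0j t It.
  have hb := hj j j0j t It.
  rewrite (@le_trans _ _ (n%:R * (e / n.+1%:R)))//.
    apply: enorm_le_of_coord; first exact: ltW.
    move=> i; rewrite !mxE distrC.
    by case: hb => _ /(_ 0 i) /ltW.
  by rewrite mulrCA ger_pMr// ler_pdivrMr// mul1r ler_nat.
have imT (f : R -> 'rV[R]_n) : (f \o clamp01) @` T = f @` T.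
  apply: eq_imagel => t Tt /=; rewrite clamp01_id//; exact: hTI.
rewrite -(imT gamma) (_ : (fun j => _) =
    (fun j => hausdorff1 ((gamma_ j \o clamp01) @` T))); last first.
  by apply/funext => j; rewrite imT.
have lip_j j s t : enorm ((gamma_ j \o clamp01) s - (gamma_ j \o clamp01) t)
    <= C * `|s - t|.
  have [_ h] := hgamma_ j.
  rewrite (le_trans (h _ _ (clamp01_unit s) (clamp01_unit t)))//.
  by rewrite ler_pM2l// clamp01_nonexpansive.
have near_clamp e : 0 < e -> exists j0, forall j, (j0 <= j)%N ->
    forall t, enorm ((gamma_ j \o clamp01) t - (gamma \o clamp01) t) <= e.
  move=> /near_gamma[j0 hj0]; exists j0 => j /hj0 h t.
  exact/h/clamp01_unit.
apply: (hausdorff1_lower_semicontinuous C) => //.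
(* The limit inherits the Lipschitz constant. *)
- move=> s t; apply/ler_addgt0Pr => e e0.
  have [j0 /(_ j0 (leqnn _)) hj] := near_clamp (e / 2) (divr_gt0 e0 (ltr0Sn _ _)).
  have := enorm_distD ((gamma_ j0 \o clamp01) s) ((gamma \o clamp01) s)
    ((gamma \o clamp01) t).
  have := enorm_distD ((gamma_ j0 \o clamp01) t) ((gamma_ j0 \o clamp01) s)
    ((gamma \o clamp01) t).
  have := lip_j j0 s t; have := hj s; have := hj t.
  rewrite (enorm_distC ((gamma \o clamp01) s) ((gamma_ j0 \o clamp01) s)); lra.
- rewrite (@le_lt_trans _ _ ((wlength (@idfun R))^*%mu `[0, 1]))//.
    by apply: le_outer_measure => t /hTI; rewrite /unit_itv /= in_itv.
  by rewrite leb_ccitv// ltry.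
Qed.
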